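(* Let $\mathcal{H}_1,\mathcal{H}_2$ be two finitely generated subgroups of $F_n\times\mathbb{A}$, where $\mathbb{A}$ is a finitely generated abelian group. Then, with the notation fixed in the context, either $(\mathcal{H}_1\cap\mathcal{H}_2)\pi$ is trivial, or $$\mathrm{St}\big((\mathcal{H}_1\cap\mathcal{H}_2)\pi,\ \mathcal{B}\big)\;\cong\;\mathrm{Cay}\Big(\bigoplus_{i=1}^{r}\mathbb{Z}/\delta_i\mathbb{Z},\ \{\{\mathbf e_i\mathbf Q\}\}_{i=1,\dots,r}\Big),$$ where $\mathcal{B}=\{w_1,\dots,w_r\}$ is a (finite) free basis of $\mathcal{H}_1\pi\cap\mathcal{H}_2\pi$, $\{\mathbf e_1,\dots,\mathbf e_r\}$ is the canonical basis of $\mathbb{Z}^r$, and $\{\{\mathbf e_i\mathbf Q\}\}_i$ is the (ordered) multiset of rows of $\mathbf Q$ interpreted as elements of $\bigoplus_{i=1}^r\mathbb{Z}/\delta_i\mathbb{Z}$; the isomorphism makes arcs labeled $w_i$ correspond to arcs labeled $\mathbf e_i\mathbf Q$ (the $i$-th element of the multiset).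
   Context: $F_n$ is a free group of finite rank $n$; elements of $F_n\times\mathbb{A}$ are written $w\,t^{\mathbf a}$; $\pi\colon F_n\times\mathbb{A}\to F_n$, $w\,t^{\mathbf a}\mapsto w$. Homomorphisms and matrices act on the right. **Notation for the intersection.** For $i=1,2$ let $L_i=\mathcal{H}_i\cap\mathbb{A}$, regarded as a subgroup of $\mathbb{A}$. Let $\{u_1t^{\mathbf a_{1,1}},\dots,u_{p_1}t^{\mathbf a_{1,p_1}}\}$ together with a generating set of $L_1$ generate $\mathcal{H}_1$, where $\{u_1,\dots,u_{p_1}\}$ is a free basis of $\mathcal{H}_1\pi$; similarly $\{v_1t^{\mathbf a_{2,1}},\dots,v_{p_2}t^{\mathbf a_{2,p_2}}\}$ for $\mathcal{H}_2$, with $\{v_j\}$ a free basis of $\mathcal{H}_2\pi$. Let $\mathcal{B}=\{w_1,\dots,w_r\}$ be a free basis of $\mathcal{H}_1\pi\cap\mathcal{H}_2\pi$ (of finite rank $r$). Let $\mathbf A_i$ be the $p_i\times 1$ column with $j$-th row $\mathbf a_{i,j}\in\mathbb{A}$, giving a homomorphism $\mathbf A_i\colon\mathbb{Z}^{p_i}\to\mathbb{A}$. Let $\mathbf B_1$ (resp. $\mathbf B_2$) be the $r\times p_1$ (resp. $r\times p_2$) integer matrix whose $j$-th row is the vector of exponent sums of $w_j$ written as a word in the $u$'s (resp. in the $v$'s). Let $\mathbf D=\mathbf B_1\mathbf A_1-\mathbf B_2\mathbf A_2\colon\mathbb{Z}^r\to\mathbb{A}$ and $M=(L_1+L_2)\mathbf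 D^{-1}\leqslant\mathbb{Z}^r$ (full preimage), with rank $s=\mathrm{rk}(M)\le r$. Let $\mathbf M$ be an $s\times r$ integer matrix whose rows form a basis of $M$, and let $\mathbf P\in GL_s(\mathbb{Z})$, $\mathbf Q\in GL_r(\mathbb{Z})$ be such that $\mathbf P\mathbf M\mathbf Q=\mathbf S=\mathrm{diag}(\delta_1,\dots,\delta_s)$ ($s\times r$) is the Smith normal form, with $\delta_1\mid\cdots\mid\delta_s$ nonzero integers; put $\delta_i=0$ for $i=s+1,\dots,r$. **Stallings automaton.** For a free group $F$ with basis $\mathcal{B}$ and $H\leqslant F$, the Schreier automaton has vertex set the right cosets $Hu$, an arc $Hu\to Huv$ labeled $v$ for each coset and each $v\in\mathcal{B}$ (together with the inverse arcs labeled $v^{-1}$), and basepoint $H$. The Stallings automaton $\mathrm{St}(H,\mathcal{B})$ is its core: the subautomaton of all vertices and arcs lying on closed walks at the basepoint without backtracking (just the basepoint if there is no nontrivial such walk). Here the ambient free group is $\mathcal{H}_1\pi\cap\mathcal{H}_2\pi$ with basis $\mathcal{B}$. **Cayley multidigraph.** For a group $G$ and a multiset $\{\{h_i\}\}_{i\in I}$ of generators of $G$ (repetitions and trivial elements allowed), $\mathrm{Cay}(G,\{\{h_i\}\}_{i\in I})$ has vertex set $G$ and one arc $g\to gh_i$ with label $h_i$ (indexed by $i$) for every $g\in G$, $i\in I$; it is viewed as a pointed involutive automaton by taking the identity as basepoint and adjoining inverse arcs. *)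

(* Defs.v *)
From HB Require Import structures.
From mathcomp Require Import all_boot all_order all_algebra.
From mathcomp Require Import mathcomp_extra boolp classical_sets functions cardinality.

Set Implicit Arguments.
Unset Strict Implicit.
Unset Printing Implicit Defensive.

Import GRing.Theory.

Local Open Scope classical_set_scope.
Local Open Scope group_scope.

Section Subgroups.
Variable G : groupType.
Implicit Types H K S : set G.

Definition is_subgroup H : Prop :=
  [/\ H 1, (forall g h, H g -> H h -> H (g * h)) & (forall g, H g -> H g^-1)].

Definition subgroup_gen S : set G := smallest is_subgroup S.

Definition fin_gen H : Prop :=
  exists2 S : set G, finite_set S & subgroup_gen S = H.

Definition right_coset H (g : G) : set G := (fun h => h * g) @` H.

End Subgroups.

Section Words.

(* A letter (i, false) stands for the i-th symbol, (i, true) for its formal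
   inverse. *)
Definition inv_letter (X : Type) (l : X * bool) : X * bool := (l.1, ~~ l.2).

Definition reduced (X : eqType) (s : seq (X * bool)) : bool :=
  sorted (fun l1 l2 => l2 != inv_letter l1) s.

Definition letter_eval (X : Type) (G : groupType) (x : X -> G) (l : X * bool) : G :=
  if l.2 then (x l.1)^-1 else x l.1.

Definition word_eval (X : Type) (G : groupType) (x : X -> G)
    (s : seq (X * bool)) : G :=
  \prod_(l <- s) letter_eval x l.

(* The family x is a free basis of H: every element of H is the value of
   exactly one freely reduced word in x, and all such values lie in H. *)
Definition free_basis (p : nat) (G : groupType) (x : 'I_p -> G) (H : set G) : Prop :=
  set_bij [set s : seq ('I_p * bool) | reduced s] H (word_eval x).

Definition exponent_sum (p : nat) (s : seq ('I_p * bool)) (k : 'I_p) : int :=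
  (\sum_(l <- s | l.1 == k) (if l.2 then - 1 else 1))%R.

(* Row j of B consists of the exponent sums of w_j written as a word in u. *)
Definition exponent_matrix (G : groupType) (p r : nat) (u : 'I_p -> G)
    (w : 'I_r -> G) (B : 'M[int]_(r, p)) : Prop :=
  forall j, exists2 s, word_eval u s = w j & forall k, B j k = exponent_sum s k.

End Words.

Section FreeTimesAbelian.
Variables (F : groupType) (A : zmodType).

(* The element w t^a is the pair (w, a). *)
Definition FxA : groupType := (F * Algebra.to_multiplicative A)%type.

Definition proj_free (H : set FxA) : set F := fst @` H.

Definition abelian_part (H : set FxA) : set A := [set a | H (1, a)].

(* u is a free basis of H pi, and the elements u_j t^(a_j) together with some
   generating set X of the abelian part generate H. *)
Definition adapted_basis (p : nat) (H : set FxA) (u : 'I_p -> F) (a : 'cV[A]_p) : Prop :=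
  free_basis u (proj_free H) /\
  exists X : set (Algebra.to_multiplicative A),
    subgroup_gen X = abelian_part H /\
    subgroup_gen (range (fun j => (u j, a j 0%R) : FxA) `|`
                  (fun l => (1, l) : FxA) @` X) = H.

End FreeTimesAbelian.

Section IntegerMatrices.
Local Open Scope ring_scope.

(* Product of an integer matrix with a column of elements of A; for m = 1 this
   is the homomorphism Z^p -> A given by the column a, acting on the right. *)
Definition zmulmx (A : zmodType) (m p : nat) (B : 'M[int]_(m, p)) (a : 'cV[A]_p) :
    'cV[A]_m :=
  \col_j \sum_k a k 0 *~ B j k.

(* The full preimage (L1 + L2) D^-1. *)
Definition preim_lattice (A : zmodType) (r : nat) (L1 L2 : set A) (D : 'cV[A]_r) :
    set 'rV[int]_r :=
  (fun x => zmulmx x D 0 0) @^-1` [set a | exists l1 l2, [/\ L1 l1, L2 l2 & a = l1 + l2]].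

Definition rows_basis (s r : nat) (B : 'M[int]_(s, r)) (M : set 'rV[int]_r) : Prop :=
  set_bij [set: 'rV[int]_s] M (fun c => c *m B).

(* S = diag(d_1, ..., d_s) as an s x r matrix; d_(s+1) = ... = d_r = 0. *)
Definition is_smith_diag (s r : nat) (S : 'M[int]_(s, r)) (d : 'I_r -> int) : Prop :=
  [/\ S = \matrix_(i < s, j < r) (if i == j :> nat then d j else 0),
      forall i : 'I_r, (i < s)%N -> d i != 0,
      forall i : 'I_r, (s <= i)%N -> d i = 0
    & forall i j : 'I_r, (i <= j)%N -> (j < s)%N -> (d i %| d j)%Z].

End IntegerMatrices.

Section DirectSum.
Local Open Scope ring_scope.

(* Z/dZ for any integer d: it is Z for d = 0 and trivial for d = 1 or d = -1,
   unlike the type 'Z_d. *)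
Local Notation int_mod d :=
  (Quotient.quot (GRing.ZmodClosed.clone int (dvdz d) _)) (only parsing).

Definition Zquot (d : int) : zmodType := int_mod d.

Definition Zquot_pi (d : int) (x : int) : Zquot d := (\pi_(int_mod d) x)%qT.

Variables (I : finType) (V : I -> zmodType).

Definition dirsum := {dffun forall i, V i}.
HB.instance Definition _ := Choice.on dirsum.

Definition dirsum_zero : dirsum := [ffun i => 0].
Definition dirsum_opp (f : dirsum) : dirsum := [ffun i => - f i].
Definition dirsum_add (f g : dirsum) : dirsum := [ffun i => f i + g i].

Fact dirsum_addA : associative dirsum_add.
Proof. by move=> f g h; apply/ffunP=> i; rewrite !ffunE addrA. Qed.
Fact dirsum_addC : commutative dirsum_add.
Proof. by move=> f g; apply/ffunP=> i; rewrite !ffunE addrC. Qed.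
Fact dirsum_add0 : left_id dirsum_zero dirsum_add.
Proof. by move=> f; apply/ffunP=> i; rewrite !ffunE add0r. Qed.
Fact dirsum_addN : left_inverse dirsum_zero dirsum_opp dirsum_add.
Proof. by move=> f; apply/ffunP=> i; rewrite !ffunE addNr. Qed.

HB.instance Definition _ :=
  GRing.isZmodule.Build dirsum dirsum_addA dirsum_addC dirsum_add0 dirsum_addN.

End DirectSum.

(* The sum of the Z / d_i Z, written multiplicatively, and the class in it of an
   integer vector. *)
Definition cyclic_sum (r : nat) (d : 'I_r -> int) : groupType :=
  Algebra.to_multiplicative (dirsum (fun i => Zquot (d i))).

Definition cyclic_sum_class (r : nat) (d : 'I_r -> int) (v : 'rV[int]_r) :
    cyclic_sum d :=
  [ffun i => Zquot_pi (d i) (v 0%R i)] : dirsum (fun i => Zquot (d i)).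

(* Pointed involutive automata: every arc has a formal inverse, and the labels
   lie in the involutive alphabet X x {false, true} of the letters above. *)
Record automaton (X : Type) := Automaton {
  vertex : Type;
  arc : Type;
  basepoint : vertex;
  source : arc -> vertex;
  target : arc -> vertex;
  label : arc -> X * bool;
  inverse : arc -> arc;
  inverseK : involutive inverse;
  source_inverse : forall e, source (inverse e) = target e;
  label_inverse : forall e, label (inverse e) = inv_letter (label e)
}.

Definition automaton_iso (X : Type) (P Q : automaton X) : Prop :=
  exists (f : vertex P -> vertex Q) (g : arc P -> arc Q),
    (bijective f /\ bijective g) /\
    [/\ f (basepoint P) = basepoint Q,
        forall e, source (g e) = f (source e),
        forall e, target (g e) = f (target e),
        forall e, label (g e) = label e
      & forall e, inverse (g e) = g (inverse e)].

Section InverseArcs.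
(* The involutive automaton obtained from an X-labelled multidigraph (V, E) by
   adjoining an inverse (e, true) to each arc (e, false). *)
Variables (X V E : Type) (v0 : V) (s t : E -> V) (l : E -> X).

Definition adjoin_src (e : E * bool) : V := if e.2 then t e.1 else s e.1.
Definition adjoin_tgt (e : E * bool) : V := if e.2 then s e.1 else t e.1.
Definition adjoin_lab (e : E * bool) : X * bool := (l e.1, e.2).

Fact adjoin_inverseK : involutive (@inv_letter E).
Proof. by case=> e []. Qed.
Fact adjoin_source e : adjoin_src (inv_letter e) = adjoin_tgt e.
Proof. by case: e => e []. Qed.
Fact adjoin_label e : adjoin_lab (inv_letter e) = inv_letter (adjoin_lab e).
Proof. by case: e => e []. Qed.

Definition adjoin_inverses : automaton X :=
  Automaton v0 adjoin_inverseK adjoin_source adjoin_label.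

End InverseArcs.

Section Core.
Variables (X : Type) (P : automaton X).

Fixpoint walk (x : vertex P) (p : seq (arc P)) (y : vertex P) : Prop :=
  if p is e :: q then source e = x /\ walk (target e) q y else x = y.

Definition no_backtracking (p : seq (arc P)) : Prop :=
  forall p1 e e' p2, p = p1 ++ [:: e, e' & p2] -> e' <> inverse e.

Definition core_vertices : set (vertex P) := [set v | exists p1 p2,
  [/\ walk (basepoint P) p1 v, walk v p2 (basepoint P) & no_backtracking (p1 ++ p2)]].

Definition core_arcs : set (arc P) := [set e | exists p1 p2,
  walk (basepoint P) (p1 ++ e :: p2) (basepoint P) /\ no_backtracking (p1 ++ e :: p2)].

Fact walk_cat x p q y :
  walk x (p ++ q) y <-> exists2 z, walk x p z & walk z q y.
Proof.
elim: p x => [|e p IH] x /=; first by split=> [h|[z -> //]]; exists x.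
split=> [[<- /IH[z pz zq]]|[z [<- pz] zq]]; first by exists z.
by split=> //; apply/IH; exists z.
Qed.

Fact target_inverse (e : arc P) : target (inverse e) = source e.
Proof. by rewrite -source_inverse inverseK. Qed.

Fact walk_inverse x p y :
  walk x p y -> walk y (map (@inverse _ P) (rev p)) x.
Proof.
elim: p x => [|e p IH] x /=; first by move=> ->.
case=> <- /IH h; rewrite rev_cons map_rcons -cats1; apply/walk_cat.
by exists (target e) => //=; rewrite source_inverse target_inverse.
Qed.

Fact no_backtracking_inverse p :
  no_backtracking p -> no_backtracking (map (@inverse _ P) (rev p)).
Proof.
move=> np p1 e e' p2 /(congr1 (fun q => map (@inverse _ P) (rev q))).
rewrite -map_rev revK (mapK (@inverseK _ P)).
rewrite rev_cat !rev_cons map_cat !map_rcons -!cats1 -!catA /= => /np h e'E.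
by apply: h; rewrite e'E inverseK.
Qed.

Fact core_basepoint : core_vertices (basepoint P).
Proof. by exists [::], [::]; split=> // -[|? ?]. Qed.

Fact core_source e : core_arcs e -> core_vertices (source e).
Proof.
move=> [p1 [p2 [/walk_cat[z wz w2] np]]].
by exists p1, (e :: p2); case: w2 => ez w2; rewrite ez.
Qed.

Fact core_inverse e : core_arcs e -> core_arcs (inverse e).
Proof.
move=> [p1 [p2 [/walk_inverse w /no_backtracking_inverse np]]].
move: w np; rewrite rev_cat rev_cons cat_rcons map_cat /=.
by move=> w np; do 2!eexists; split; [exact: w | exact: np].
Qed.

Fact core_target e : core_arcs e -> core_vertices (target e).
Proof. by move=> /core_inverse/core_source; rewrite source_inverse. Qed.

Definition core_base : core_vertices := SigSub (mem_set core_basepoint).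
Definition core_src (e : core_arcs) : core_vertices :=
  SigSub (mem_set (core_source (set_valP e))).
Definition core_tgt (e : core_arcs) : core_vertices :=
  SigSub (mem_set (core_target (set_valP e))).
Definition core_lab (e : core_arcs) : X * bool := label (set_val e).
Definition core_inv (e : core_arcs) : core_arcs :=
  SigSub (mem_set (core_inverse (set_valP e))).

Fact core_invK : involutive core_inv.
Proof. by move=> e; apply: val_inj; exact: inverseK. Qed.
Fact core_src_inv e : core_src (core_inv e) = core_tgt e.
Proof. by apply: val_inj; exact: source_inverse. Qed.
Fact core_lab_inv e : core_lab (core_inv e) = inv_letter (core_lab e).
Proof. exact: label_inverse. Qed.

Definition core : automaton X :=
  Automaton core_base core_invK core_src_inv core_lab_inv.

End Core.

Section Schreier.
(* The ambient free group is the subgroup generated by w, of which w is meant to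
   be a free basis; the arc (C, i) goes from C to C w_i and has label w_i. *)
Variables (G : groupType) (r : nat) (w : 'I_r -> G) (H : set G).

Definition right_cosets : set (set G) :=
  right_coset H @` subgroup_gen (range w).

Fact right_cosets_base : right_cosets H.
Proof.
exists 1; first by move=> K [[K1 _ _] _].
rewrite /right_coset; apply/seteqP; split=> [_ [h Hh <-]|h Hh]; first by rewrite mulg1.
by exists h; rewrite ?mulg1.
Qed.

Fact right_cosets_step C i : right_cosets C -> right_cosets (right_coset C (w i)).
Proof.
move=> [u Ku <-]; exists (u * w i).
  move=> K KP; have [[_ KM _] wK] := KP.
  by apply: KM; [exact: Ku | apply: wK; exists i].
apply/seteqP; split=> [_ [h Hh <-]|_ [_ [h Hh <-] <-]].
  by exists (h * u); [exists h | rewrite mulgA].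
by exists h => //; rewrite mulgA.
Qed.

Definition coset_step (e : right_cosets * 'I_r) : right_cosets :=
  SigSub (mem_set (right_cosets_step e.2 (set_valP e.1))).

Definition schreier : automaton 'I_r :=
  adjoin_inverses (SigSub (mem_set right_cosets_base)) fst coset_step snd.

Definition stallings : automaton 'I_r := core schreier.

End Schreier.

(* Arcs are labelled by the index i rather than by the element h_i, since h is a
   multiset: distinct indices give distinct labels. *)
Definition cayley (I : Type) (G : groupType) (h : I -> G) : automaton I :=
  adjoin_inverses (1 : G) (fun e : G * I => e.1) (fun e => e.1 * h e.2) snd.

(* Main.v *)
Require Import Defs.
From mathcomp Require Import all_boot all_order all_algebra.
From mathcomp Require Import mathcomp_extra boolp classical_sets functions cardinality.

Set Implicit Arguments.
Unset Strict Implicit.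
Unset Printing Implicit Defensive.

(** Write [N] for the projection of [H1 `&` H2] to the free factor and [K] for
the intersection of the two projections, the free group on [w].  The idea is
that membership of an element of [K] in [N] is a linear condition on its vector
of exponents.

Lift each [w_j] to an element of [H1] and to an element of [H2].  The abelian
coordinates of the lifts are the rows of [B1 A1] and [B2 A2], since in the
abelian factor the value of a word depends only on its exponents
([word_eval_exponents], [adapted_lift]).  For a word with exponent vector [y]
the possible abelian coordinates therefore form a coset of [L1] inside [H1] and
a coset of [L2] inside [H2]; the two cosets meet exactly when [y D] lies in
[L1 + L2], that is, when [y] lies in the lattice spanned by the rows of [M]
([proj_intersection]).  After the change of coordinates [Q] this lattice becomes
the direct sum of the [delta_i Z] ([smith_class_lattice]).  Hence a word in [w]
has its value in [N] iff the same word, evaluated at the rows of [Q] in the sum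
of the [Z / delta_i Z], is trivial.

So [N] is the kernel of a surjection from [K] to this sum of cyclic groups, and
the Schreier automaton of [N] is the Cayley automaton of the quotient
([schreier_iso_cayley]).  It remains to see that the Schreier automaton is its
own core as soon as [N] is nontrivial.  Through the isomorphism this is a
statement about Cayley automata of abelian groups with a nontrivial reduced
relator: every arc, or its inverse, ends a reduced path from the identity, and
every such path extends to a reduced closed one ([reduced_closure],
[cayley_core_arcs]).  If a
second generator is available, a commutator does this; with only one generator
the relator says that it has finite order, and the path goes on around the
cycle. *)

Import GRing.Theory.
Local Open Scope classical_set_scope.
Local Open Scope group_scope.

(** * Values of words *)

Section Words.
Variable X : Type.

Definition inv_word (s : seq (X * bool)) : seq (X * bool) :=
  map (@inv_letter X) (rev s).

Lemma inv_letterK : involutive (@inv_letter X).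
Proof. exact: adjoin_inverseK. Qed.

Variables (G : groupType) (x : X -> G).
Implicit Types s t : seq (X * bool).

Lemma word_eval_nil : word_eval x [::] = 1.
Proof. exact: big_nil. Qed.

Lemma word_eval_cons l s : word_eval x (l :: s) = letter_eval x l * word_eval x s.
Proof. exact: big_cons. Qed.

Lemma word_eval_cat s t : word_eval x (s ++ t) = word_eval x s * word_eval x t.
Proof.
elim: s => [|l s IH]; first by rewrite word_eval_nil mul1g.
by rewrite /= !word_eval_cons IH mulgA.
Qed.

Lemma word_eval_letter l : word_eval x [:: l] = letter_eval x l.
Proof. by rewrite word_eval_cons word_eval_nil mulg1. Qed.

Lemma word_eval_rcons s l : word_eval x (rcons s l) = word_eval x s * letter_eval x l.
Proof. by rewrite -cats1 word_eval_cat word_eval_letter. Qed.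

Lemma word_eval_nseq k l : word_eval x (nseq k l) = letter_eval x l ^+ k.
Proof.
elim: k => [|k IH]; first by rewrite word_eval_nil expg0.
by rewrite /= word_eval_cons IH expgS.
Qed.

Lemma letter_eval_inv l : letter_eval x (inv_letter l) = (letter_eval x l)^-1.
Proof. by case: l => i []; rewrite /letter_eval /= ?invgK. Qed.

Lemma word_eval_inv s : word_eval x (inv_word s) = (word_eval x s)^-1.
Proof.
elim: s => [|l s IH]; first by rewrite /inv_word /= word_eval_nil invg1.
rewrite /inv_word rev_cons map_rcons word_eval_rcons -/(inv_word s) IH.
by rewrite letter_eval_inv word_eval_cons invgM.
Qed.

Lemma subgroup_word_eval (H : set G) s :
  is_subgroup H -> (forall i, H (x i)) -> H (word_eval x s).
Proof.
move=> [H1 HM HV] Hx; elim: s => [|[i b] s IH]; first by rewrite word_eval_nil.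
by rewrite word_eval_cons; apply: HM => //; case: b; [apply: HV|]; apply: Hx.
Qed.

Lemma subgroup_gen_range : subgroup_gen (range x) = range (word_eval x).
Proof.
apply/seteqP; split=> [g Kg|_ [s _ <-] K [KG xK]].
  apply: Kg; split; last first.
    by move=> _ [i _ <-]; exists [:: (i, false)] => //; exact: word_eval_letter.
  split; first by exists [::] => //; exact: word_eval_nil.
    by move=> _ _ [s _ <-] [t _ <-]; exists (s ++ t) => //; exact: word_eval_cat.
  by move=> _ [s _ <-]; exists (inv_word s) => //; exact: word_eval_inv.
by apply: subgroup_word_eval => // i; apply: xK; exists i.
Qed.

End Words.

(** * Reduced words and reduced relators *)

Section Reduced.
Variables (X : eqType) (G : groupType) (x : X -> G).
Implicit Types s t : seq (X * bool).

Lemma inv_letter_neq (l m : X * bool) : (m != inv_letter l) = (l != inv_letter m).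
Proof. by rewrite eq_sym (can2_eq (@inv_letterK X) (@inv_letterK X)). Qed.

Lemma reduced_inv s : reduced (inv_word s) = reduced s.
Proof.
rewrite /reduced /inv_word sorted_map rev_sorted; apply: eq_sorted => l m.
by rewrite /= (inj_eq (can_inj (@inv_letterK X))) inv_letter_neq.
Qed.

Lemma reduced_rcons s l m :
  reduced (rcons (rcons s l) m) = reduced (rcons s l) && (m != inv_letter l).
Proof.
by case: s => [|k s]; rewrite /reduced /= ?andbT // !rcons_path last_rcons.
Qed.

Lemma word_eval_reduce s : exists2 t, reduced t & word_eval x t = word_eval x s.
Proof.
elim: s => [|l s [t rt ts]]; first by exists [::].
rewrite word_eval_cons -ts; case: t rt {ts} => [|m t] rt.
  by exists [:: l] => //; rewrite word_eval_cons.
have [mE|ml] := eqVneq m (inv_letter l).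
  exists t; first exact: path_sorted rt.
  by rewrite word_eval_cons mE letter_eval_inv mulgA mulgV mul1g.
by exists [:: l, m & t]; rewrite ?word_eval_cons //= /reduced /= ml.
Qed.

Lemma reduced_nseq i s : {in s, forall l, l.1 = i} -> reduced s ->
  exists b, s = nseq (size s) (i, b).
Proof.
elim: s => [|[j b] s IH] si; first by exists false.
move=> rs; have [c sE] : exists c, s = nseq (size s) (i, c).
  by apply: IH; [move=> l ls; apply: si; rewrite inE ls orbT | exact: path_sorted rs].
have ji : j = i by apply: (si (j, b)); rewrite inE eqxx.
exists b; rewrite /= ji; case: s sE rs {IH si} => //= m s [-> sE] /andP[mb _].
suff cb : c = b by rewrite -cb {1}sE.
by apply: contraNeq mb => cb; rewrite /inv_letter ji xpair_eqE eqxx; case: (b) (c) cb => [] [].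
Qed.

Hypothesis mulC : forall a b : G, a * b = b * a.

(** The extension is the commutator of the path [y := rcons t l] with a letter
[c] on another generator, which is [m] or its inverse. *)
Lemma reduced_closure_commutator t (l m : X * bool) : reduced (rcons t l) -> m.1 != l.1 ->
  exists2 z, reduced (rcons t l ++ z) & word_eval x (rcons t l ++ z) = 1.
Proof.
move=> ry ml; set y := rcons t l in ry *.
(* The word y c y^-1 c^-1 can only cancel where y^-1 meets c^-1, which depends
   on the first letter of y; it cannot be the inverse of both m and m^-1. *)
have [c cl cy] : exists2 c : X * bool, c.1 != l.1 & head l y != inv_letter c.
  have [hm|hm] := eqVneq (head l y) (inv_letter m); last by exists m.
  exists (inv_letter m) => //; rewrite hm inv_letterK.
  by case: (m) => i []; rewrite xpair_eqE andbF.
exists (c :: rcons (inv_word y) (inv_letter c)); last first.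
  rewrite word_eval_cat word_eval_cons word_eval_rcons word_eval_inv letter_eval_inv.
  by rewrite (mulC (letter_eval x c)) -mulgA mulVg mulg1 mulgV.
(* c y^-1 c^-1 is the inverse of c y c^-1, whose reducedness is read off the
   two ends of y. *)
have rcy : reduced (c :: rcons y (inv_letter c)).
  move: ry cy; rewrite /reduced /y /= rcons_path last_rcons.
  case: (t) => [|a q] /= => [_|->] ->; rewrite (inj_eq (can_inj (@inv_letterK X))).
    by apply: contraNneq cl => ->.
  by apply: contraNneq cl => ->.
move: (rcy); rewrite -reduced_inv /inv_word rev_cons rev_rcons map_rcons /= inv_letterK.
rewrite -/(inv_word y) /reduced /= sorted_cat_cons => ->; rewrite andbT.
rewrite -/(reduced (rcons y c)) reduced_rcons -/y ry /=.
by apply: contraNneq cl => ->.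
Qed.

(** A reduced word in one generator is a power of a letter, so the relator [s]
makes both this letter and its inverse have an order dividing [size s]; going on with
the last letter of [y] then eventually returns to 1. *)
Lemma reduced_closure_power i (y s : seq (X * bool)) :
    {in y, forall l, l.1 = i} -> {in s, forall l, l.1 = i} ->
    reduced y -> reduced s -> s != [::] -> word_eval x s = 1 ->
  exists2 z, reduced (y ++ z) & word_eval x (y ++ z) = 1.
Proof.
move=> yi si /(reduced_nseq yi)[b ->] /(reduced_nseq si)[c ->].
case: (size s) => // d _; rewrite word_eval_nseq => cd1.
have bd1 : letter_eval x (i, b) ^+ d.+1 = 1.
  have [<-//|cb] := eqVneq c b; rewrite -[(i, b)]inv_letterK letter_eval_inv expVgn.
  by rewrite /inv_letter /= (_ : ~~ b = c) ?cd1 ?invg1 //; case: (b) (c) cb => [] [].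
(* With d.+1 the size of s, the total length becomes a multiple of d.+1. *)
exists (nseq (size y * d) (i, b)); rewrite -nseqD -mulnS.
  rewrite /reduced; elim: (size y * d.+1)%N => //= -[|k] //= ->.
  by rewrite andbT /inv_letter xpair_eqE eqxx; case: (b).
by rewrite word_eval_nseq mulnC expgnA bd1 expg1n.
Qed.

(** What makes a Cayley automaton of an abelian group its own core: a reduced
path from the basepoint can always be prolonged to a reduced closed one, once
there is a nontrivial reduced relator [s].  The relator matters only if there is
a single generator; otherwise commutators are relators. *)
Lemma reduced_closure t l s :
    reduced (rcons t l) -> reduced s -> s != [::] -> word_eval x s = 1 ->
  exists2 z, reduced (rcons t l ++ z) & word_eval x (rcons t l ++ z) = 1.
Proof.
move=> ry rs s0 s1.
have [[m ml]|one] := pselect (exists m, m != l.1).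
  exact: (reduced_closure_commutator (m := (m, false)) ry).
have lE (q : seq (X * bool)) : {in q, forall k, k.1 = l.1}.
  by move=> k _; apply/eqP; apply: contra_notT one => kl; exists k.1.
exact: reduced_closure_power (lE _) (lE _) ry rs s0 s1.
Qed.

End Reduced.

(** * Isomorphisms of automata and cores *)

Section Automata.
Variable X : Type.
Implicit Types P Q R : automaton X.

Lemma automaton_iso_sym P Q : automaton_iso P Q -> automaton_iso Q P.
Proof.
move=> [f [g [[[f' fK f'K] [g' gK g'K]] [fb gs gt gl gi]]]].
exists f', g'; split; [split; [by exists f|by exists g]|split].
- by rewrite -fb fK.
- by move=> e; rewrite -{2}(g'K e) gs fK.
- by move=> e; rewrite -{2}(g'K e) gt fK.
- by move=> e; rewrite -{2}(g'K e) gl.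
- by move=> e; rewrite -{2}(g'K e) gi gK.
Qed.

Lemma automaton_iso_trans P Q R :
  automaton_iso P Q -> automaton_iso Q R -> automaton_iso P R.
Proof.
move=> [f [g [[fB gB] [fb gs gt gl gi]]]] [f' [g' [[f'B g'B] [f'b g's g't g'l g'i]]]].
exists (f' \o f), (g' \o g); split; first by split; exact: bij_comp.
split=> [|e|e|e|e] /=; first by rewrite fb.
- by rewrite g's gs.
- by rewrite g't gt.
- by rewrite g'l gl.
- by rewrite g'i gi.
Qed.

Lemma automaton_iso_core_arcs P Q :
  automaton_iso P Q -> @core_arcs _ P = setT -> @core_arcs _ Q = setT.
Proof.
move=> [f [g [[_ [g' gK g'K]] [fb gs gt _ gi]]]] PT.
have walk_map (y : vertex P) p (x : vertex P) : walk x p y -> walk (f x) (map g p) (f y).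
  elim: p x => [|e p IH] x /=; first by move=> ->.
  by case=> <- /IH h; rewrite gs gt.
apply/seteqP; split=> // e _.
have /= : @core_arcs X P (g' e) by rewrite PT.
move=> [p1 [p2 [/walk_map w nb]]]; exists (map g p1), (map g p2).
have E : map g p1 ++ e :: map g p2 = map g (p1 ++ g' e :: p2) by rewrite map_cat /= g'K.
rewrite E -fb; split=> // q1 d d' q2 /(congr1 (map g')).
rewrite (mapK gK) map_cat /= => /nb nd dE; apply: nd.
by apply: (can_inj gK); rewrite dE -gi !g'K.
Qed.

Lemma core_full P : @core_vertices _ P = setT -> @core_arcs _ P = setT ->
  automaton_iso (core P) P.
Proof.
move=> VT ET; exists set_val, set_val.
have bij T (U : set T) : U = setT -> bijective (set_val : U -> T).
  move=> UT; have inU v : v \in U by rewrite UT in_setT.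
  by exists (fun v => SigSub (inU v)) => [v|v]; [apply: val_inj|].
by split; [split; exact: bij|split].
Qed.

End Automata.

(** An arc and its inverse carry inverse labels, so a reduced label forbids
backtracking in any automaton. *)
Lemma reduced_no_backtracking (X : eqType) (P : automaton X) (p : seq (Defs.arc P)) :
  reduced [seq label e | e <- p] -> no_backtracking p.
Proof.
move=> + p1 e e' p2 pE; rewrite pE map_cat /reduced sorted_cat_cons /=.
by move=> /and3P[_ + _] e'E; rewrite e'E label_inverse eqxx.
Qed.

(** * Cayley automata of abelian groups *)

Section Cayley.
Variables (X : eqType) (G : groupType) (h : X -> G).
Local Notation C := (cayley h).

(** The arc leaving [g] with label [l].  For an inverse letter it is the formal
inverse of the arc that ends at [g], hence starts at [g * (h l.1)^-1]. *)
Definition cayley_arc (g : G) (l : X * bool) : Defs.arc C :=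
  ((if l.2 then g * (h l.1)^-1 else g, l.1), l.2).

Lemma cayley_arc_source g l : source (cayley_arc g l) = g.
Proof. by case: l => i [] //=; rewrite /adjoin_src /= mulgVK. Qed.

Lemma cayley_arc_target g l : target (cayley_arc g l) = g * letter_eval h l.
Proof. by case: l => i []. Qed.

Lemma cayley_arc_label g l : label (cayley_arc g l) = l.
Proof. by case: l. Qed.

Lemma cayley_arcE (e : Defs.arc C) : e = cayley_arc (source e) (label e).
Proof. by case: e => [[g i] []] //=; rewrite /cayley_arc /adjoin_src /= mulgK. Qed.

Fixpoint cayley_walk (g : G) (s : seq (X * bool)) : seq (Defs.arc C) :=
  if s is l :: t then cayley_arc g l :: cayley_walk (g * letter_eval h l) t else [::].

Lemma cayley_walkP g s : @walk _ C g (cayley_walk g s) (g * word_eval h s).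
Proof.
elim: s g => [|l s IH] g /=; first by rewrite word_eval_nil mulg1.
split; first exact: cayley_arc_source.
by rewrite word_eval_cons mulgA -cayley_arc_target; exact: IH.
Qed.

Lemma cayley_walk_label g s : [seq label e | e <- cayley_walk g s] = s.
Proof. by elim: s g => //= l s IH g; rewrite IH; case: l. Qed.

Lemma cayley_walk_cat g s t :
  cayley_walk g (s ++ t) = cayley_walk g s ++ cayley_walk (g * word_eval h s) t.
Proof.
elim: s g => [|l s IH] g /=; first by rewrite word_eval_nil mulg1.
by rewrite IH word_eval_cons mulgA.
Qed.

(** Every arc, or its inverse, is the last arc of the walk of some reduced word,
and [reduced_closure] closes that walk. *)
Lemma cayley_core_arcs (s : seq (X * bool)) :
    (forall a b : G, a * b = b * a) -> range (word_eval h) = setT ->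
    reduced s -> s != [::] -> word_eval h s = 1 ->
  @core_arcs _ C = setT.
Proof.
move=> mulC hT rs s0 s1.
have last_core t l : reduced (rcons t l) -> @core_arcs _ C (cayley_arc (word_eval h t) l).
  move=> ry; have [z rz z1] := reduced_closure mulC ry rs s0 s1.
  exists (cayley_walk 1 t), (cayley_walk (word_eval h (rcons t l)) z).
  have := cayley_walkP 1 (rcons t l ++ z); rewrite z1 mulg1.
  have := cayley_walk_label 1 (rcons t l ++ z).
  rewrite {1 3}cat_rcons cayley_walk_cat /= !mul1g -word_eval_rcons.
  by move=> lE w; split=> //; apply: reduced_no_backtracking; rewrite lE.
apply/seteqP; split=> // e _.
have [t rt te] : exists2 t, reduced t & word_eval h t = source e.
  have [u _ <-] : range (word_eval h) (source e) by rewrite hT.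
  exact: word_eval_reduce.
rewrite (cayley_arcE e) -te.
case/lastP: t rt te => [|t l] rt te; first exact: (last_core [::]).
(* If the label of e cancels the last letter l of t, then the inverse of e is the
   last arc on the walk of t itself. *)
have [lE|lE] := eqVneq (label e) (inv_letter l); last first.
  by apply: last_core; rewrite reduced_rcons rt.
rewrite te -cayley_arcE -(inverseK e); apply: core_inverse.
rewrite (cayley_arcE (inverse e)) source_inverse label_inverse lE inv_letterK.
rewrite {1}(cayley_arcE e) cayley_arc_target -te lE letter_eval_inv word_eval_rcons mulgK.
exact: last_core.
Qed.

End Cayley.

(** * Schreier automata *)

Lemma subgroupI (G : groupType) (H K : set G) :
  is_subgroup H -> is_subgroup K -> is_subgroup (H `&` K).
Proof.
move=> [H1 HM HV] [K1 KM KV]; split=> //.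
  by move=> g h [Hg Kg] [Hh Kh]; split; [exact: HM | exact: KM].
by move=> g [Hg Kg]; split; [exact: HV | exact: KV].
Qed.

(** The hypotheses say that [w_i |-> h_i] induces an isomorphism from the quotient
of the group generated by [w] by its intersection with [N] onto [K]. *)
Section SchreierCayley.
Variables (G K : groupType) (r : nat) (w : 'I_r -> G) (h : 'I_r -> K) (N : set G).
Hypotheses (NG : is_subgroup N) (hT : range (word_eval h) = setT).
Hypothesis Nh : forall s, N (word_eval w s) <-> word_eval h s = 1.

Lemma right_coset_eq g g' :
  right_coset N g = right_coset N g' <-> N (g * g'^-1).
Proof.
have [N1 NM NV] := NG.
split=> [/seteqP[sub _]|Ngg'].
  have [|n Nn ng] := sub g; first by exists 1; rewrite ?mul1g.
  by rewrite -ng mulgK.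
apply/seteqP; split=> _ [n Nn <-].
  by exists (n * (g * g'^-1)); [exact: NM | rewrite -!mulgA mulVg mulg1].
exists (n * (g * g'^-1)^-1); first by apply: NM => //; exact: NV.
by rewrite invgM invgK -!mulgA mulVg mulg1.
Qed.

Lemma right_coset_word s t :
  right_coset N (word_eval w s) = right_coset N (word_eval w t) <->
  word_eval h s = word_eval h t.
Proof.
rewrite right_coset_eq -word_eval_inv -word_eval_cat Nh word_eval_cat word_eval_inv.
split=> [st|->]; last by rewrite mulgV.
by rewrite -[LHS](mulgVK (word_eval h t)) st mul1g.
Qed.

Lemma right_cosets_word (C : right_cosets w N) :
  exists s, right_coset N (word_eval w s) = set_val C.
Proof.
have [g] := set_valP C; rewrite subgroup_gen_range => -[s _ <-] sC.
by exists s.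
Qed.

(** Two words in [w] lead to the same coset of [N] iff they have the same value in
[h], so a coset is sent to the value in [h] of any word leading to it. *)
Lemma schreier_iso_cayley : automaton_iso (schreier w N) (cayley h).
Proof.
pose word_of C := sval (cid (right_cosets_word C)).
pose f C := word_eval h (word_of C).
have fE C s : set_val C = right_coset N (word_eval w s) -> f C = word_eval h s.
  by rewrite -(svalP (cid (right_cosets_word C))) => /right_coset_word.
have fB : bijective f.
  rewrite -setTT_bijective; split=> // [C C' _ _ ff|g _].
    suff: set_val C = set_val C' by exact: val_inj.
    rewrite -(svalP (cid (right_cosets_word C))).
    by rewrite -(svalP (cid (right_cosets_word C'))); exact/right_coset_word.
  have [s _ <-] : range (word_eval h) g by rewrite hT.
  have sC : right_cosets w N (right_coset N (word_eval w s)).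
    by exists (word_eval w s) => //; rewrite subgroup_gen_range; exists s.
  by exists (SigSub (mem_set sC)) => //; exact: fE.
have fstep (e : right_cosets w N * 'I_r) : f (coset_step e) = f e.1 * h e.2.
  have [s sC] := right_cosets_word e.1.
  rewrite (fE e.1 s) // (fE _ (rcons s (e.2, false))) ?word_eval_rcons //=.
  rewrite (_ : set_val _ = right_coset (set_val e.1) (w e.2)) // -sC.
  apply/seteqP; split=> [_ [_ [n Nn <-] <-]|_ [n Nn <-]].
    by exists n => //; rewrite mulgA.
  by exists (n * word_eval w s); rewrite ?mulgA //; exists n.
have [f' fK f'K] := fB.
exists f, (fun e => ((f e.1.1, e.1.2), e.2)); split; [split|split] => //.
- by exists (fun e => ((f' e.1.1, e.1.2), e.2)) => -[[C i] b] /=; rewrite ?fK ?f'K.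
- rewrite /= (fE _ [::]) word_eval_nil //=.
  apply/seteqP; split=> [n Nn|_ [n Nn <-]]; last by rewrite mulg1.
  by exists n; rewrite ?mulg1.
- by case=> [[C i] []] //=; rewrite /adjoin_src /= fstep.
- by case=> [[C i] []] //=; rewrite /adjoin_tgt /= fstep.
Qed.

(** A nontrivial element of [N] is the value of a nonempty reduced word, which is
a relator of [K]; hence the Schreier automaton is its own core. *)
Lemma stallings_iso_cayley g :
    (forall a b : K, a * b = b * a) -> N `<=` range (word_eval w) -> N g -> g <> 1 ->
  automaton_iso (stallings w N) (cayley h).
Proof.
move=> mulC Nw Ng g1.
have [s rs sg] : exists2 s, reduced s & word_eval w s = g.
  by have [t _ <-] := Nw g Ng; exact: word_eval_reduce.
have s0 : s != [::] by apply: contra_notN g1 => /eqP s0; rewrite -sg s0 word_eval_nil.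
have hs1 : word_eval h s = 1 by apply/Nh; rewrite sg.
have arcsT : @core_arcs _ (schreier w N) = setT.
  apply: automaton_iso_core_arcs (automaton_iso_sym schreier_iso_cayley) _.
  exact: cayley_core_arcs hT rs s0 hs1.
apply: automaton_iso_trans schreier_iso_cayley; apply: core_full => //.
have [i _] : exists i : 'I_r, True by case: (s) s0 => // l; exists l.1.
apply/seteqP; split=> // C _.
have e : @core_arcs _ (schreier w N) ((C, i), false) by rewrite arcsT.
exact: (core_source e).
Qed.

End SchreierCayley.

(** * Exponent vectors *)

Section ExponentVectors.
Local Open Scope ring_scope.
Variable p : nat.
Implicit Types s t : seq ('I_p * bool).

Definition exponents s : 'rV[int]_p := \row_k exponent_sum s k.

Lemma exponents_cat s t : exponents (s ++ t) = exponents s + exponents t.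
Proof. by apply/rowP => k; rewrite !mxE /exponent_sum big_cat. Qed.

Lemma exponents_nil : exponents [::] = 0.
Proof. by apply/rowP => k; rewrite !mxE /exponent_sum big_nil. Qed.

Lemma exponents_letter i b : exponents [:: (i, b)] = (if b then -1 else 1) *: delta_mx 0 i.
Proof.
apply/rowP => k; rewrite !mxE eqxx /exponent_sum big_cons big_nil /= eq_sym.
by case: eqP; rewrite ?mulr1 ?mulr0 ?addr0.
Qed.

Lemma exponents_inv s : exponents (inv_word s) = - exponents s.
Proof.
elim: s => [|[i b] s IH]; first by rewrite /inv_word /= exponents_nil oppr0.
rewrite /inv_word rev_cons map_rcons -cats1 exponents_cat -/(inv_word s) IH.
rewrite -[(i, b) :: s]cat1s exponents_cat opprD addrC !exponents_letter -scaleNr.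
by case: b; rewrite ?opprK.
Qed.

(** The exponent vectors form a subgroup of [Z^p] that contains the canonical
basis. *)
Lemma exponents_surj x : exists s, exponents s = x.
Proof.
pose T := [set y | exists s, exponents s = y].
have TD y z : T y -> T z -> T (y + z).
  by move=> [s <-] [t <-]; exists (s ++ t); rewrite exponents_cat.
have TN y : T y -> T (- y) by move=> [s <-]; exists (inv_word s); rewrite exponents_inv.
have T0 : T 0 by exists [::]; rewrite exponents_nil.
have TMn y n : T y -> T (y *+ n).
  by move=> Ty; elim: n => [|n IH]; rewrite ?mulr0n // mulrS; exact: TD.
have TZ y (a : int) : T y -> T (a *: y).
  move=> Ty; rewrite -[a]intz scaler_int.
  by case: a => n; [exact: TMn | rewrite NegzE mulrNz; apply/TN/TMn].
suff : T x by [].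
rewrite (row_sum_delta x); apply: (big_ind T) => // i _; apply: TZ.
by exists [:: (i, false)]; rewrite exponents_letter scale1r.
Qed.

Lemma word_eval_exponents (V : zmodType) (x : 'I_p -> Algebra.to_multiplicative V) s :
  word_eval x s = (\sum_k (x k : V) *~ exponents s 0 k : V).
Proof.
elim: s => [|[i b] s IH].
  by rewrite word_eval_nil exponents_nil big1 // => k _; rewrite !mxE mulr0z.
rewrite word_eval_cons IH -cat1s exponents_cat exponents_letter.
under [RHS]eq_bigr do rewrite mxE mulrzDr.
rewrite big_split /=; congr (_ + _).
rewrite (bigD1 i) //= big1 ?addr0 => [|k ki]; rewrite !mxE eqxx.
  by rewrite eqxx mulr1 /letter_eval; case: b.
by rewrite (negbTE ki) mulr0 mulr0z.
Qed.

End ExponentVectors.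


(** * Intersections in the product of a free and an abelian group *)

Section Intersection.
Variables (F : groupType) (A : zmodType).

Lemma proj_free_subgroup (H : set (FxA F A)) : is_subgroup H -> is_subgroup (proj_free H).
Proof.
move=> [H1 HM HV]; split; first by exists 1.
  by move=> _ _ [g Hg <-] [h Hh <-]; exists (g * h) => //; exact: HM.
by move=> _ [g Hg <-]; exists g^-1 => //; exact: HV.
Qed.

Lemma word_eval_pair (p : nat) (u : 'I_p -> F) (a : 'cV[A]_p) s :
  word_eval (fun j => (u j, a j 0%R) : FxA F A) s =
  (word_eval u s, zmulmx (exponents s) a 0%R 0%R).
Proof.
rewrite mxE -(word_eval_exponents (fun k => a k 0%R)).
elim: s => [|[i b] s IH]; first by rewrite !word_eval_nil.
by rewrite !word_eval_cons IH; case: b.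
Qed.

(** The abelian coordinates above a fixed [g] form a coset of the abelian part. *)
Lemma abelian_coset (H : set (FxA F A)) (g : F) (a b : A) : is_subgroup H ->
  H (g, a) -> H (g, b) <-> abelian_part H (b - a)%R.
Proof.
move=> [_ HM HV] Ha.
have ba : ((1, (b - a)%R) : FxA F A) = ((g, b) : FxA F A) * ((g, a) : FxA F A)^-1.
  by congr (_, _); rewrite /= mulgV.
split=> [Hb|Hba]; first by rewrite /abelian_part /= ba; apply: HM => //; exact: HV.
by rewrite -[(g, b)](mulgVK ((g, a) : FxA F A)) -ba; exact: HM.
Qed.

(** The pairs of [w_j] and the [j]-th row of [B a] lie in [H], being values of
words in the generators [(u_k, a_k)]; evaluating [s] at these pairs gives an
element of [H] above the value of [s]. *)
Lemma adapted_lift (p r : nat) (H : set (FxA F A)) (u : 'I_p -> F) (a : 'cV[A]_p)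
    (w : 'I_r -> F) (B : 'M[int]_(r, p)) s :
    is_subgroup H -> adapted_basis H u a -> exponent_matrix u w B ->
  H (word_eval w s, zmulmx (exponents s) (zmulmx B a) 0%R 0%R).
Proof.
move=> HG [_ [X [_ HE]]] wB.
have Hu j : H (u j, a j 0%R) by rewrite -HE => K [_ sub]; apply: sub; left; exists j.
have Hw j : H (w j, zmulmx B a j 0%R).
  have [t <- BE] := wB j.
  suff -> : zmulmx B a j 0%R = zmulmx (exponents t) a 0%R 0%R.
    by rewrite -word_eval_pair; exact: subgroup_word_eval.
  by rewrite !mxE; apply: eq_bigr => k _; rewrite mxE BE.
by rewrite -word_eval_pair; exact: subgroup_word_eval.
Qed.

(** Above the value of [s] the abelian coordinates form the coset of [L1] through
[a1 = y B1 A1] in [H1] and the coset of [L2] through [a2 = y B2 A2] in [H2], where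
[y] is the exponent vector of [s]; they meet iff [a1 - a2 = y D] is in [L1 + L2]. *)
Lemma proj_intersection (r p1 p2 : nat) (H1 H2 : set (FxA F A))
    (u : 'I_p1 -> F) (v : 'I_p2 -> F) (A1 : 'cV[A]_p1) (A2 : 'cV[A]_p2)
    (w : 'I_r -> F) (B1 : 'M[int]_(r, p1)) (B2 : 'M[int]_(r, p2)) s :
    is_subgroup H1 -> is_subgroup H2 ->
    adapted_basis H1 u A1 -> adapted_basis H2 v A2 ->
    exponent_matrix u w B1 -> exponent_matrix v w B2 ->
  proj_free (H1 `&` H2) (word_eval w s) <->
  preim_lattice (abelian_part H1) (abelian_part H2)
    (zmulmx B1 A1 - zmulmx B2 A2)%R (exponents s).
Proof.
move=> G1 G2 hu hv hB1 hB2.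
have := adapted_lift s G1 hu hB1; have := adapted_lift s G2 hv hB2.
rewrite /preim_lattice /=.
have -> : zmulmx (exponents s) (zmulmx B1 A1 - zmulmx B2 A2)%R 0%R 0%R =
  (zmulmx (exponents s) (zmulmx B1 A1) 0%R 0%R
   - zmulmx (exponents s) (zmulmx B2 A2) 0%R 0%R)%R.
  rewrite 3!mxE -sumrB; apply: eq_bigr => k _.
  by rewrite -mulrzBl; congr (_ *~ _)%R; rewrite !mxE.
set a1 := zmulmx _ (zmulmx B1 A1) _ _; set a2 := zmulmx _ _ _ _ => Ha2 Ha1.
split=> [[[g b] /= [H1b H2b] gE]|[l1 [l2 [L1 L2 E]]]].
  rewrite gE in H1b H2b; exists (a1 - b)%R, (b - a2)%R.
  split; last by rewrite addrA subrK.
    exact/(abelian_coset _ G1 H1b).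
  exact/(abelian_coset _ G2 Ha2).
exists (word_eval w s, (l2 + a2)%R) => //; split; last first.
  by apply/(abelian_coset _ G2 Ha2); rewrite addrK.
apply/(abelian_coset _ G1 Ha1); have [_ _ HV] := G1.
suff -> : (l2 + a2 - a1 = - l1)%R.
  have := HV _ L1; rewrite /abelian_part /=; congr (H1 (_, _)); exact: invg1.
have -> : (a1 = l1 + (l2 + a2))%R by rewrite addrA -E subrK.
by rewrite opprD addrCA subrr addr0.
Qed.

End Intersection.

(** * Sums of cyclic groups and the Smith normal form *)

Section CyclicSums.
Variables (r : nat) (d : 'I_r -> int).
Implicit Types v : 'rV[int]_r.
Local Notation cls := (cyclic_sum_class d).

Lemma Zquot_piD e x y : Zquot_pi e (x + y)%R = (Zquot_pi e x + Zquot_pi e y)%R.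
Proof. exact: Quotient.pi_add. Qed.

Lemma Zquot_pi_eq0 e x : Zquot_pi e x = 0%R <-> (e %| x)%Z.
Proof.
rewrite -[X in (e %| X)%Z]subr0 -[(e %| _)%Z]/(_ \in dvdz e) Quotient.idealrBE.
have pi0 : Zquot_pi e 0 = 0%R.
  by apply: (addrI (Zquot_pi e 0)); rewrite -Zquot_piD !addr0.
by rewrite -pi0; split=> [/eqP|/eqP].
Qed.

Lemma cyclic_sum_classD v1 v2 : cls (v1 + v2)%R = cls v1 * cls v2.
Proof. by apply/ffunP => i; rewrite !ffunE mxE Zquot_piD. Qed.

Lemma cyclic_sum_class_eq1 v : cls v = 1 <-> forall i, (d i %| v 0%R i)%Z.
Proof.
split=> [v1 i|dv]; first by apply/Zquot_pi_eq0; move/ffunP: v1 => /(_ i); rewrite !ffunE.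
by apply/ffunP => i; rewrite !ffunE; exact/Zquot_pi_eq0.
Qed.

Lemma cyclic_sum_class0 : cls 0%R = 1.
Proof. by apply/cyclic_sum_class_eq1 => i; rewrite mxE dvdz0. Qed.

Lemma cyclic_sum_classN v : cls (- v)%R = (cls v)^-1.
Proof.
by apply: (mulgI (cls v)); rewrite -cyclic_sum_classD subrr cyclic_sum_class0 mulgV.
Qed.

Lemma cyclic_sum_class_surj g : exists v, cls v = g.
Proof.
exists (\row_i repr (g i))%R; apply/ffunP => i.
by rewrite ffunE mxE /Zquot_pi reprK.
Qed.

Lemma cyclic_sum_mulC (g1 g2 : cyclic_sum d) : g1 * g2 = g2 * g1.
Proof. exact: addrC. Qed.

Lemma word_eval_cyclic_sum (p : nat) (Q : 'M[int]_(p, r)) s :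
  word_eval (fun i => cls (delta_mx 0 i *m Q)%R) s = cls (exponents s *m Q)%R.
Proof.
elim: s => [|[i b] s IH].
  by rewrite word_eval_nil exponents_nil mul0mx cyclic_sum_class0.
rewrite word_eval_cons IH -[in RHS]cat1s exponents_cat mulmxDl cyclic_sum_classD.
congr (_ * _); rewrite exponents_letter /letter_eval /=.
by case: b; rewrite ?scale1r // scaleN1r mulNmx cyclic_sum_classN.
Qed.

Lemma cyclic_sum_generated (Q : 'M[int]_r) : Q \in unitmx ->
  range (word_eval (fun i => cls (delta_mx 0 i *m Q)%R)) = setT.
Proof.
move=> Qu; apply/seteqP; split=> // g _.
have [v <-] := cyclic_sum_class_surj g.
have [s sv] := exponents_surj (v *m invmx Q)%R.
by exists s => //; rewrite word_eval_cyclic_sum sv mulmxKV.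
Qed.

(** A coordinate [j] beyond [s] is zero on the row lattice of [S]; divisibility
expresses this too, because [d j = 0] there and only 0 is a multiple of 0. *)
Lemma smith_diag_lattice (s : nat) (S : 'M[int]_(s, r)) v : is_smith_diag S d ->
  (exists c, (c *m S)%R = v) <-> forall j, (d j %| v 0%R j)%Z.
Proof.
move=> [SE _ d0 _].
have cS (c : 'rV[int]_s) j :
    ((c *m S) 0 j = (if insub (j : nat) is Some i then c 0 i else 0) * d j)%R.
  rewrite mxE SE; case: insubP => [i _ ij|js].
    rewrite (bigD1 i) //= big1 ?addr0 => [|k ki]; rewrite mxE ?ij ?eqxx //.
    by rewrite -ij val_eqE (negbTE ki) mulr0.
  rewrite mul0r big1 // => k _; rewrite mxE; case: eqP => [kj|_]; last by rewrite mulr0.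
  by move: js; rewrite -kj ltn_ord.
split=> [[c <-] j|dv]; first by rewrite cS dvdz_mull.
pose q (i : nat) : int := if insub i is Some j then (v 0%R j %/ d j)%Z else 0%R.
exists (\row_i q i)%R; apply/rowP => j; rewrite cS.
case: insubP => [i _ ij|js]; last first.
  have := dv j; rewrite d0 ?dvd0z ?mul0r; first by move/eqP.
  by rewrite leqNgt.
by rewrite mxE /q ij valK divzK.
Qed.

End CyclicSums.

(** Right multiplication by [Q] carries the row lattice of [M], which is also that
of [P M], onto the row lattice of [S]. *)
Lemma smith_class_lattice (s r : nat) (L : set 'rV[int]_r) (M S : 'M[int]_(s, r))
    (P : 'M[int]_s) (Q : 'M[int]_r) (delta : 'I_r -> int) v :
    rows_basis M L -> P \in unitmx -> Q \in unitmx -> is_smith_diag S delta ->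
    (P *m M *m Q = S)%R ->
  L v <-> cyclic_sum_class delta (v *m Q)%R = 1.
Proof.
move=> [ML _ LM] Pu Qu hS PMQ.
rewrite cyclic_sum_class_eq1 -(smith_diag_lattice _ hS) -PMQ.
split=> [/LM[c _ <-]|[c cE]].
  by exists (c *m invmx P)%R; rewrite !mulmxA mulmxKV.
have -> : v = (c *m P *m M)%R.
  by apply: (can_inj (mulmxK Qu)); rewrite -cE !mulmxA.
exact: ML.
Qed.

(** * The Stallings automaton of the intersection *)

Local Open Scope ring_scope.

Theorem theorem4p14
  (F : groupType) (n : nat) (x : 'I_n -> F) (hF : free_basis x setT)
  (A : zmodType) (hA : fin_gen [set: Algebra.to_multiplicative A])
  (H1 H2 : set (FxA F A))
  (hH1 : is_subgroup H1) (hH2 : is_subgroup H2)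
  (fgH1 : fin_gen H1) (fgH2 : fin_gen H2)
  (p1 p2 : nat) (u : 'I_p1 -> F) (v : 'I_p2 -> F)
  (A1 : 'cV[A]_p1) (A2 : 'cV[A]_p2)
  (hu : adapted_basis H1 u A1) (hv : adapted_basis H2 v A2)
  (r : nat) (w : 'I_r -> F)
  (hw : free_basis w (proj_free H1 `&` proj_free H2))
  (B1 : 'M[int]_(r, p1)) (B2 : 'M[int]_(r, p2))
  (hB1 : exponent_matrix u w B1) (hB2 : exponent_matrix v w B2)
  (D : 'cV[A]_r) (hD : D = zmulmx B1 A1 - zmulmx B2 A2)
  (s : nat) (M : 'M[int]_(s, r))
  (hM : rows_basis M (preim_lattice (abelian_part H1) (abelian_part H2) D))
  (P : 'M[int]_s) (Q : 'M[int]_r) (S : 'M[int]_(s, r)) (delta : 'I_r -> int)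
  (hP : P \in unitmx) (hQ : Q \in unitmx)
  (hS : is_smith_diag S delta) (hPMQ : P *m M *m Q = S) :
  proj_free (H1 `&` H2) = [set 1%g]
  \/ automaton_iso (stallings w (proj_free (H1 `&` H2)))
       (cayley (fun i => cyclic_sum_class delta (delta_mx 0 i *m Q))).
Proof.
set N := proj_free (H1 `&` H2).
have NG : is_subgroup N by exact: proj_free_subgroup (subgroupI hH1 hH2).
have Nh t : N (word_eval w t) <->
    word_eval (fun i => cyclic_sum_class delta (delta_mx 0 i *m Q)) t = 1%g.
  rewrite word_eval_cyclic_sum -(smith_class_lattice _ hM hP hQ hS hPMQ) hD.
  exact: proj_intersection hH1 hH2 hu hv hB1 hB2.
have Nw : N `<=` range (word_eval w).
  move=> _ [g [H1g H2g] <-]; have [_ _ wK] := hw.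
  by have [|t _ tg] := wK g.1; [split; exists g | exists t].
have [[g [Ng g1]]|N1] := pselect (exists g, N g /\ g <> 1%g).
  right; apply: stallings_iso_cayley Ng g1 => //; last exact: cyclic_sum_mulC.
  exact: cyclic_sum_generated.
left; apply/seteqP; split=> [g Ng|_ ->]; last by case: NG.
by apply: contra_notP N1 => g1; exists g.
Qed.
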